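(* Let $G$ be a finite group. If $2\mid|G/G'|$ (equivalently, $G$ has a quotient isomorphic to $C_2$; equivalently, $G$ has an index-$2$ subgroup; equivalently, $G$ has a linear character of order $2$), then $2\in C_{\mathrm{char}}(G)$.
   Context: $G'$ denotes the derived subgroup of $G$. Character probe: for $\chi\in\operatorname{Irr}(G)$ (irreducible complex characters), the Galois-orbit trace of $\chi$ is the integer-valued class function $$\operatorname{OrbTr}(\chi)(c)=\sum_{\psi\in\operatorname{Gal}(\overline{\mathbb{Q}}/\mathbb{Q})\cdot\chi}\psi(c),$$ the sum over the distinct characters in the Galois orbit of $\chi$, evaluated at conjugacy classes $c$ of $G$. Let $P$ be the integer matrix with rows indexed by $\operatorname{Irr}(G)$, columns indexed by the conjugacy classes of $G$, and entries $P_{\chi,c}=\operatorname{OrbTr}(\chi)(c)$. Let $M_{\mathrm{char}}(G)$ be the $\mathbb{Z}$-span of all differences of rows $P_\chi-P_{\chi'}$. The character conductor is the set of primes $C_{\mathrm{char}}(G)=\{p\text{ prime}:\operatorname{rank}_{\mathbb{F}_p}(M_{\mathrm{char}}(G)\bmod p)<\operatorname{rank}_{\mathbb{Q}}M_{\mathrm{char}}(G)\}$, where $M\bmod p$ is the image of $M$ in the reduction modulo $p$ of the ambient integer lattice. *)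

(* Defs.v *)
From HB Require Import structures.
From mathcomp Require Import all_boot all_order all_algebra all_fingroup.
From mathcomp Require Import all_solvable all_field all_character.
From mathcomp Require Import boolp classical_sets.

Set Implicit Arguments.
Unset Strict Implicit.
Unset Printing Implicit Defensive.

Import Order.TTheory GRing.Theory Num.Theory.

Local Open Scope ring_scope.
Local Open Scope classical_set_scope.

(* Maximal size of a linearly independent family of elements of S, i.e. the
   dimension of the F-span of S. *)
Definition dim_span (F : fieldType) (n : nat) (S : set 'rV[F]_n) : nat :=
  (\max_(r < n.+1 |
     `[< exists A : 'M[F]_(r, n), (forall i, S (row i A)) /\ row_free A >]) r)%N.

Lemma dim_span_rank (F : fieldType) (m n : nat) (S : set 'rV[F]_n)
    (D : 'M[F]_(m, n)) :
  (forall i, S (row i D)) -> (forall v, S v -> (v <= D)%MS) ->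
  dim_span S = \rank D.
Proof.
move=> SD DS; apply/eqP; rewrite eqn_leq; apply/andP; split.
  apply/bigmax_leqP => r /asboolP[A [SA /eqP <-]].
  by apply/mxrankS/row_subP => i; apply: DS.
have ltr : (\rank D < n.+1)%N by rewrite ltnS rank_leq_col.
apply: (@leq_bigmax_cond _ _ _ (Ordinal ltr)); apply/asboolP => /=.
exists (rowsub (maxrankfun D) D); split; last exact: maxrowsub_free.
by move=> i; rewrite row_rowsub; apply: SD.
Qed.

(* The image in F^n of a set of integer vectors; for F = 'F_p this is the
   reduction modulo p, for F = rat the inclusion of Z^n in Q^n. *)
Definition lattice_image (F : fieldType) (n : nat) (M : set 'rV[int]_n) :
    set 'rV[F]_n :=
  [set map_mx intr v | v in M].
Arguments lattice_image F {n} M.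

Section CharacterProbe.

Variables (gT : finGroupType) (G : {group gT}).

(* Gal(Qbar/Q) is the set of ring endomorphisms of algC, all of which are
   bijective, since algC is an algebraic closure of Q. *)
Definition galois_orbit (i : Iirr G) : {set Iirr G} :=
  [set j | `[< exists u : {rmorphism algC -> algC},
                 'chi_j = cfAut u 'chi_i >]]%SET.

Definition OrbTr (i : Iirr G) : 'CF(G) := \sum_(j in galois_orbit i) 'chi_j.

Lemma OrbTr_int (i : Iirr G) (x : gT) : OrbTr i x \in Num.int.
Proof.
have [Gx | /cfun0->] := boolP (x \in G); last exact: rpred0.
apply: Cint_rat_Aint; last first.
  by rewrite sum_cfunE rpred_sum // => j _; apply: Aint_irr.
have fixO (u : {rmorphism algC -> algC}) : u (OrbTr i x) = OrbTr i x.
  have orbM j : (aut_Iirr u j \in galois_orbit i) = (j \in galois_orbit i).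
    have stab k : k \in galois_orbit i -> aut_Iirr u k \in galois_orbit i.
      rewrite !inE => -[v Dk].
      pose uv : {rmorphism algC -> algC} := u \o v; exists uv.
      by rewrite aut_IirrE Dk; apply/cfunP => y; rewrite !cfunE.
    have defO : aut_Iirr u @: galois_orbit i = galois_orbit i.
      apply/eqP; rewrite eqEcard card_imset ?leqnn ?andbT;
        last exact: aut_Iirr_inj.
      by apply/fintype.subsetP => _ /imsetP[k Ok ->]; apply: stab.
    by rewrite -{1}defO mem_imset //; apply: aut_Iirr_inj.
  rewrite !sum_cfunE rmorph_sum [RHS](reindex_inj (aut_Iirr_inj u)) /=.
  by apply: eq_big => [j|j _]; rewrite ?orbM // aut_IirrE cfunE.
have [Qn galQn [QnC gQnC [_ _ Qn_g]]] := group_num_field_exists <[x]>.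
have [a Da] : exists a, QnC a = OrbTr i x.
  have ex j : {b | QnC b = 'chi[G]_j x}.
    by apply: (Qn_g _ G _ (irr_char j) x); rewrite dvdnn.
  exists (\sum_(j in galois_orbit i) sval (ex j)).
  rewrite rmorph_sum sum_cfunE; apply: eq_bigr => j _.
  exact: svalP (ex j).
have : a \in fixedField 'Gal({:Qn} / 1)%g.
  apply/fixedFieldP => [|nu gal_nu]; first exact: memvf.
  apply: (fmorph_inj QnC).
  have [f ->] := gQnC nu.
  by rewrite Da fixO.
rewrite (galois_fixedField galQn) => /vlineP[/= c Dc].
by rewrite -Da Dc rmorphZ_num rmorph1 mulr1 Crat_rat.
Qed.

(* OrbTr is integer-valued by OrbTr_int, so Num.floor only changes the type
   of its values from algC to int; see char_matrixE. *)
Definition char_matrix : 'M[int]_(Nirr G, #|classes G|) :=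
  \matrix_(i, c) Num.floor (OrbTr i (repr (enum_val c))).

Lemma char_matrixE (i : Iirr G) (x : gT) (c : 'I_#|classes G|) :
  x \in enum_val c -> (char_matrix i c)%:~R = OrbTr i x.
Proof.
rewrite mxE floorK ?OrbTr_int //.
have /repr_classesP[_ {1}->] := enum_valP c.
by case/imsetP=> y Gy ->; rewrite cfunJ.
Qed.

Definition M_char : set 'rV[int]_#|classes G| :=
  [set v | exists a : Iirr G -> Iirr G -> int,
     v = \sum_i \sum_j (row i char_matrix - row j char_matrix) *~ a i j].

Definition C_char : set nat :=
  [set p | prime p /\
     (dim_span (lattice_image 'F_p M_char)
        < dim_span (lattice_image rat M_char))%N].

End CharacterProbe.

(* Main.v *)
Require Import Defs.
From mathcomp Require Import all_boot all_order all_algebra all_fingroup.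
From mathcomp Require Import all_solvable all_field all_character.
From mathcomp Require Import boolp classical_sets.

(** The equivalences pass through the group of linear characters of G, which is
    the dual of the abelian group G / G' and has the same order. If that order
    is even, Cauchy's theorem yields a linear character chi of order two
    ([even_abelianization_lin_char]); its kernel has a quotient of order two
    ([card_quotient_cfker_lin]), hence index two; and a subgroup of index two
    contains G', which makes #|G / G'| even ([index2_even_abelianization]).

    For the conductor, write P_i for the row of OrbTr i. The lattice is
    generated by the differences P_i - P_0 with the row of the trivial
    character, and P_i only depends on the Galois orbit of i. Orbit traces of
    distinct orbits are sums of disjoint sets of irreducible characters, so the
    differences attached to the r - 1 nontrivial orbits are independent over
    the rationals: the rank is r - 1 ([rank_diff_matrix_rat] gives the
    inequality that matters). A character chi of order two takes only the values 1
    and -1 on G, so it is rational, is alone in its orbit, and its row differs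
    from the row of ones by entries 0 and -2. That difference vanishes
    modulo 2, so at most r - 2 differences survive and the rank drops
    ([rank_diff_matrix_F2]). *)

Set Implicit Arguments.
Unset Strict Implicit.
Unset Printing Implicit Defensive.

Import Order.TTheory GRing.Theory Num.Theory.

Local Open Scope ring_scope.

(** * Linear characters of order two and subgroups of index two *)

Lemma cforder2_values (gT : finGroupType) (G : {group gT}) (chi : 'CF(G)) x :
  #[chi]%CF = 2%N -> x \in G -> chi x = 1 \/ chi x = -1.
Proof.
move=> o2 Gx; have := exp_cforder chi.
rewrite o2 => /cfunP/(_ x)/eqP.
by rewrite expS_cfunE // cfun1E Gx sqrf_eq1 => /pred2P.
Qed.

(** The linear characters form a group of order #|G : G'|, so Cauchy's theorem
    applies to that group. *)
Lemma even_abelianization_lin_char (gT : finGroupType) (G : {group gT}) :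
  (2 %| #|(G / G^`(1))%g|)%N ->
  exists2 chi : 'CF(G), chi \is a linear_char & #[chi]%CF = 2%N.
Proof.
have [lG [cF [_ cardG linF _] [_ _ _ _ oF]]] := lin_char_group G.
rewrite card_quotient ?der_norm // -cardG -cardsT => /(Cauchy (erefl : prime 2)).
by case=> u _ o2; exists (cF u); rewrite ?oF.
Qed.

Lemma lin_char_even_abelianization (gT : finGroupType) (G : {group gT})
    (chi : 'CF(G)) :
  chi \is a linear_char -> #[chi]%CF = 2%N -> (2 %| #|(G / G^`(1))%g|)%N.
Proof.
have [lG [cF [_ cardG _ onF] [_ _ _ _ oF]]] := lin_char_group G.
move=> /onF[u ->]; rewrite oF card_quotient ?der_norm // -cardG -cardsT => <-.
exact/order_dvdG/finset.in_setT.
Qed.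

(** A linear character takes values of modulus one, so its center is the whole
    of G; the center of a character is cyclic modulo the kernel, so that the
    order of the quotient equals its exponent, which is the order of chi. *)
Lemma card_quotient_cfker_lin (gT : finGroupType) (G : {group gT})
    (chi : 'CF(G)) :
  chi \is a linear_char -> #|(G / cfker chi)%g| = #[chi]%CF.
Proof.
move=> lin_chi.
have ZG : 'Z(chi)%CF = G :> {set gT}.
  apply/eqP; rewrite finset.eqEsubset cfcenter_sub; apply/fintype.subsetP => x Gx.
  rewrite char_cfcenterE ?lin_charW //.
  by rewrite normC_lin_char // lin_char1.
rewrite cforder_lin_char // exponent_cyclic //.
by have := cfcenter_cyclic chi; rewrite /= ZG.
Qed.

Lemma lin_char_quotient_C2 (gT : finGroupType) (G : {group gT})
    (chi : 'CF(G)) :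
  chi \is a linear_char -> #[chi]%CF = 2%N ->
  exists2 N : {group gT}, (N <| G)%g & ((G / N)%g \isog Zp 2).
Proof.
move=> lin_chi o2; exists [group of cfker chi]; first exact: cfker_normal.
have oGK : #|(G / cfker chi)%g| = 2%N by rewrite card_quotient_cfker_lin.
by rewrite isog_cyclic_card ?prime_cyclic ?oGK ?card_Zp.
Qed.

Lemma quotient_C2_index2 (gT : finGroupType) (G N : {group gT}) :
  (N <| G)%g -> ((G / N)%g \isog Zp 2) -> #|G : N|%g = 2%N.
Proof.
by move=> nNG /card_isog; rewrite card_Zp // card_quotient ?normal_norm.
Qed.

(** A subgroup H of index two is normal with abelian quotient, hence contains
    the derived subgroup, and the index of H divides that of G'. *)
Lemma index2_even_abelianization (gT : finGroupType) (G H : {group gT}) :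
  H \subset G -> #|G : H|%g = 2%N -> (2 %| #|(G / G^`(1))%g|)%N.
Proof.
move=> sHG iH; have /andP[_ nHG] := index2_normal sHG iH.
have sG'H : (G^`(1) \subset H)%g.
  by rewrite der1_min // cyclic_abelian // prime_cyclic // card_quotient ?iH.
by rewrite card_quotient ?der_norm // -(Lagrange_index sHG sG'H) iH dvdn_mulr.
Qed.

(** * Galois orbits and their traces *)

Section GaloisOrbits.

Variables (gT : finGroupType) (G : {group gT}).
Implicit Types (i j k : Iirr G).

Lemma galois_orbitP i j :
  reflect (exists u : {rmorphism algC -> algC}, 'chi_j = cfAut u 'chi_i)
          (j \in galois_orbit i).
Proof. by rewrite inE; apply: asboolP. Qed.

Lemma galois_orbit_refl i : i \in galois_orbit i.
Proof. by apply/galois_orbitP; exists idfun; apply/cfunP=> x; rewrite cfunE. Qed.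

Lemma galois_orbit_sym i j : j \in galois_orbit i -> i \in galois_orbit j.
Proof.
case/galois_orbitP=> u Dj; apply/galois_orbitP; exists (algC_invaut u).
by apply/cfunP=> x; rewrite Dj !cfunE /= algC_autK.
Qed.

Lemma galois_orbit_trans i j k :
  j \in galois_orbit i -> k \in galois_orbit j -> k \in galois_orbit i.
Proof.
case/galois_orbitP=> u Dj /galois_orbitP[v Dk]; apply/galois_orbitP.
pose vu : {rmorphism algC -> algC} := v \o u.
by exists vu; apply/cfunP=> x; rewrite Dk Dj !cfunE.
Qed.

Lemma galois_orbit_eq i j :
  j \in galois_orbit i -> galois_orbit j = galois_orbit i.
Proof.
move=> Oij; apply/setP=> k; apply/idP/idP; first exact: galois_orbit_trans.
exact/galois_orbit_trans/galois_orbit_sym.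
Qed.

Lemma galois_orbit_rat i :
  (forall (u : {rmorphism algC -> algC}), cfAut u 'chi_i = 'chi_i) ->
  galois_orbit i = [set i].
Proof.
move=> fix_i; apply/setP=> j; rewrite finset.in_set1.
apply/galois_orbitP/eqP=> [[u]|->].
  by rewrite fix_i => /irr_inj.
by exists idfun; rewrite fix_i.
Qed.

Lemma galois_orbit0 : galois_orbit (0 : Iirr G) = [set 0].
Proof. by apply: galois_orbit_rat => u; rewrite irr0 rmorph1. Qed.

(** The values of such a character are 0, 1 and -1, which every field
    automorphism fixes. *)
Lemma galois_orbit_order2 i :
  #['chi_i]%CF = 2%N -> galois_orbit i = [set i].
Proof.
move=> o2; apply: galois_orbit_rat => u; apply/cfunP=> x; rewrite cfunE.
have [Gx | /cfun0->] := boolP (x \in G); last by rewrite rmorph0.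
by have [->|->] := cforder2_values o2 Gx; rewrite ?rmorphN rmorph1.
Qed.

Lemma OrbTr_rat i : galois_orbit i = [set i] -> OrbTr i = 'chi_i.
Proof. by rewrite /OrbTr => ->; rewrite big_set1. Qed.

(** OrbTr i is a multiplicity-free sum of irreducible characters, so pairing
    with irreducible characters recovers the orbit: this is what makes traces
    of distinct orbits linearly independent. *)
Lemma cfdot_OrbTr_irr i j : '[OrbTr i, 'chi_j] = (j \in galois_orbit i)%:R.
Proof.
rewrite cfdot_suml (eq_bigr (fun k => (k == j)%:R)) => [|k _]; last first.
  exact: cfdot_irr.
have [Oj | O'j] := boolP (j \in _).
  by rewrite (bigD1 j) //= eqxx big1 ?addr0 // => k /andP[_ /negPf->].
by rewrite big1 // => k Ok; case: eqP => // Dk; rewrite -Dk Ok in O'j.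
Qed.

(** The choice is made from the orbit as a set, so it is constant on orbits;
    the default i is never returned, as orbits are nonempty. *)
Definition orbit_rep i : Iirr G := odflt i [pick j in galois_orbit i].

Lemma mem_orbit_rep i : orbit_rep i \in galois_orbit i.
Proof.
by rewrite /orbit_rep; case: pickP => //= _; apply: galois_orbit_refl.
Qed.

Lemma orbit_rep_eq i j : j \in galois_orbit i -> orbit_rep j = orbit_rep i.
Proof.
move=> Oij; rewrite /orbit_rep (galois_orbit_eq Oij).
by case: pickP => // /(_ i); rewrite galois_orbit_refl.
Qed.

Lemma orbit_rep_rat i : galois_orbit i = [set i] -> orbit_rep i = i.
Proof. by move=> Oi; have := mem_orbit_rep i; rewrite Oi => /set1P. Qed.

Lemma orbit_repK i : orbit_rep (orbit_rep i) = orbit_rep i.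
Proof. exact/orbit_rep_eq/mem_orbit_rep. Qed.

Definition nontrivial_reps : {set Iirr G} :=
  [set i | (i != 0) && (orbit_rep i == i)]%SET.

(** The differences of OrbTr with the trivial character are dual to the chosen
    representatives of the nontrivial orbits. *)
Lemma cfdot_OrbTr_reps i j :
  i \in nontrivial_reps -> j \in nontrivial_reps ->
  '[OrbTr i - OrbTr 0, 'chi_j] = (i == j)%:R.
Proof.
rewrite !inE => /andP[_ /eqP ri] /andP[/negPf nzj /eqP rj].
rewrite cfdotBl !cfdot_OrbTr_irr galois_orbit0 finset.in_set1 nzj subr0; congr (_%:R).
congr (nat_of_bool _); apply/idP/eqP=> [Oij | ->]; last exact: galois_orbit_refl.
by rewrite -ri -rj (orbit_rep_eq Oij).
Qed.

(** * Rank of the character lattice *)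

(** The rows of this matrix generate the image in F of the character lattice,
    since P_i - P_j = (P_i - P_0) - (P_j - P_0). *)
Definition diff_matrix (F : fieldType) : 'M[F]_(Nirr G, #|classes G|) :=
  \matrix_(i, c) (char_matrix G i c - char_matrix G 0 c)%:~R.

Lemma dim_span_M_char (F : fieldType) :
  Defs.dim_span (lattice_image F (@M_char gT G)) = \rank (diff_matrix F).
Proof.
apply: dim_span_rank => [i | v [w [a ->] <-]].
  exists (row i (char_matrix G) - row 0 (char_matrix G)); last first.
    by apply/rowP=> c; rewrite !mxE.
  (* The coefficients that select the single difference P_i - P_0. *)
  exists (fun j k => ((j == i) && (k == 0))%:R).
  rewrite (bigD1 i) //= (bigD1 0) //= !eqxx mulr1z.
  rewrite big1 ?addr0 => [|k /negPf->]; last by rewrite andbF.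
  rewrite big1 ?addr0 // => j /negPf->; by rewrite big1.
pose D := \matrix_i (row i (char_matrix G) - row 0 (char_matrix G)).
have Drow i : map_mx intr (row i D) = row i (diff_matrix F).
  by apply/rowP=> c; rewrite !mxE.
rewrite raddf_sum summx_sub // => i _; rewrite raddf_sum summx_sub // => j _.
have -> : row i (char_matrix G) - row j (char_matrix G) = row i D - row j D.
  by rewrite !rowK opprB addrA subrK.
rewrite raddfMz raddfB /= !Drow -scaler_int scalemx_sub //.
by rewrite addmx_sub ?eqmx_opp ?row_sub.
Qed.

Lemma row_diff_matrix_rep (F : fieldType) i :
  row (orbit_rep i) (diff_matrix F) = row i (diff_matrix F).
Proof.
apply/rowP=> c; rewrite !mxE /OrbTr.
by rewrite (galois_orbit_eq (mem_orbit_rep i)).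
Qed.

Lemma row_diff_matrix0 (F : fieldType) : row 0 (diff_matrix F) = 0.
Proof. by apply/rowP=> c; rewrite !mxE subrr. Qed.

(** In characteristic zero there is one independent row per nontrivial orbit:
    a linear relation between rows is, read in algC, a relation between class
    functions, and the dual family of representatives kills its coefficients. *)
Lemma rank_diff_matrix_rat :
  (#|nontrivial_reps| <= \rank (diff_matrix rat))%N.
Proof.
pose e (k : 'I_#|nontrivial_reps|) : Iirr G := enum_val k.
have freeA : row_free (rowsub e (diff_matrix rat)).
  apply: inj_row_free => v vA0; apply/rowP=> k; rewrite [RHS]mxE.
  suff comb0 : \sum_l ratr (v 0 l) *: (OrbTr (e l) - OrbTr 0) = 0 :> 'CF(G).
    (* Pairing the relation with 'chi_(e k) isolates the coefficient v 0 k. *)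
    apply: (fmorph_inj (@ratr algC)); rewrite rmorph0.
    have := congr1 (fun phi => '[phi, 'chi_(e k)]) comb0.
    rewrite cfdot0l cfdot_suml (bigD1 k) //= big1 ?addr0 => [|l ne_lk].
      by rewrite cfdotZl cfdot_OrbTr_reps ?enum_valP // eqxx mulr1.
    rewrite cfdotZl cfdot_OrbTr_reps ?enum_valP //.
    by rewrite (inj_eq enum_val_inj) (negPf ne_lk) mulr0.
  apply/cfunP=> x; rewrite cfunE sum_cfunE.
  have [Gx | G'x] := boolP (x \in G); last first.
    by rewrite big1 // => l _; rewrite cfunE cfun0 ?mulr0.
  pose c := enum_rank_in (mem_classes Gx) (x ^: G)%g.
  have xc : x \in enum_val c by rewrite enum_rankK_in ?mem_classes ?class_refl.
  have := congr1 (ratr : rat -> algC) (congr1 (fun w : 'rV_ _ => w 0 c) vA0).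
  rewrite !mxE rmorph0 rmorph_sum /= => sum0; rewrite -[RHS]sum0.
  apply: eq_bigr => l _; rewrite !cfunE !mxE rmorphM /= ratr_int.
  by rewrite -!(char_matrixE _ xc) !mxE rmorphB.
rewrite -{1}(eqP freeA) mxrankS //.
by apply/row_subP=> k; rewrite row_rowsub row_sub.
Qed.

(** The values of 'chi_i are 1 and -1, so P_i - P_0 only has entries 0 and -2:
    row i vanishes modulo 2, and the rank is at most the number of the other
    nontrivial orbits. *)
Lemma rank_diff_matrix_F2 i :
  i \in nontrivial_reps -> #['chi_i]%CF = 2%N ->
  (\rank (diff_matrix 'F_2) < #|nontrivial_reps|)%N.
Proof.
move=> Ri o2; rewrite [X in (_ < X)%N](cardsD1 i) Ri ltnS.
pose E := nontrivial_reps :\ i; rewrite -/E.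
pose e (k : 'I_#|E|) : Iirr G := enum_val k.
have rowi0 : row i (diff_matrix 'F_2) = 0.
  apply/rowP=> c; rewrite [LHS]mxE [LHS]mxE [RHS]mxE.
  have [y Gy Dc] := imsetP (enum_valP c).
  have yc : y \in enum_val c by rewrite Dc class_refl.
  have valE (m : int) j : 'chi_j y = m%:~R -> galois_orbit j = [set j] ->
      char_matrix G j c = m.
    move=> Dm Oj; apply: (@intr_inj algC).
    by rewrite (char_matrixE j yc) OrbTr_rat.
  rewrite (valE 1 0) ?galois_orbit0 //; last by rewrite irr0 cfun1E Gy.
  have Oi := galois_orbit_order2 o2.
  have [v|v] := cforder2_values o2 Gy.
    by rewrite (valE 1 i v Oi) subrr.
  (* -1 - 1 = -2 is zero in 'F_2, by computation. *)
  by rewrite (valE (-1) i v Oi); apply/eqP.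
apply: leq_trans (rank_leq_row (rowsub e (diff_matrix 'F_2))).
apply/mxrankS/row_subP=> j; rewrite -row_diff_matrix_rep.
have [->|nz] := eqVneq (orbit_rep j) 0; first by rewrite row_diff_matrix0 sub0mx.
have [->|nei] := eqVneq (orbit_rep j) i; first by rewrite rowi0 sub0mx.
have Ej : orbit_rep j \in E by rewrite !inE nei nz orbit_repK eqxx.
rewrite -(enum_rankK_in Ej Ej) -[enum_val _]/(e _) -row_rowsub.
exact: row_sub.
Qed.

Lemma lin_char_order2_conductor (chi : 'CF(G)) :
  chi \is a linear_char -> #[chi]%CF = 2%N -> C_char G 2%N.
Proof.
move=> lin_chi; have /irrP[i ->] := lin_char_irr lin_chi => o2; split=> //.
rewrite !dim_span_M_char.
apply: leq_trans (rank_diff_matrix_F2 _ o2) rank_diff_matrix_rat.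
rewrite inE orbit_rep_rat ?galois_orbit_order2 // eqxx andbT.
apply: contra_eqN o2 => /eqP->.
have : (#[1%R : 'CF(G)]%CF %| 1)%N by rewrite dvdn_cforder expr1n.
by rewrite irr0 dvdn1 => /eqP->.
Qed.

End GaloisOrbits.

Theorem theorem7p1 (gT : finGroupType) (G : {group gT}) :
  [<-> (2 %| #|(G / G^`(1))%g|)%N;
       exists2 N : {group gT}, (N <| G)%g & ((G / N)%g \isog Zp 2);
       exists2 H : {group gT}, H \subset G & #|G : H|%g = 2%N;
       exists2 chi : 'CF(G), chi \is a linear_char & #[chi]%CF = 2%N] /\
  ((2 %| #|(G / G^`(1))%g|)%N -> C_char G 2%N).
Proof.
split=> [|/even_abelianization_lin_char[chi]]; last first.
  exact: lin_char_order2_conductor.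
tfae=> [/even_abelianization_lin_char[chi]|[N nNG isoGN]|[H sHG iH]|[chi]].
- exact: lin_char_quotient_C2.
- by exists N; [apply: normal_sub | apply: quotient_C2_index2].
- exact/even_abelianization_lin_char/(index2_even_abelianization sHG).
- exact: lin_char_even_abelianization.
Qed.
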